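(* Let $\ell\le 0$ and suppose that $\psi\in\Psi_\ell$. Fix $\delta,\beta\geq 0$, with the additional constraint that $\psi'(0+)=\psi(0)=0$ if $\beta=0$. Then $\mathcal{T}_{\delta,\beta}\psi\in\Psi_{\ell-\beta}\subseteq\Psi_\ell$ and $\mathcal{T}_{\delta,\beta}\psi$ has no killing component. Moreover, if $\psi$ has killing rate $\kappa$, Gaussian coefficient $\sigma$ and jump measure $\Pi$, then $\mathcal{T}_{\delta,\beta}\psi$ also has Gaussian coefficient $\sigma$ and its Lévy measure is given by $$e^{\beta x}\,\Pi(dx)+\delta e^{\beta x}\,\overline{\Pi}(x)\,dx+\delta\frac{\kappa}{\beta}\,e^{\beta x}\,dx\quad\text{on }(-\infty,0),$$ where $\overline{\Pi}(x)=\Pi(-\infty,x)$ for $x<0$, and the final term is understood to be zero whenever $\kappa=0$.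
   Context: A (possibly killed) Lévy process with no positive jumps $\xi=(\xi_t,t\ge0)$, killed at an independent rate $\kappa\ge 0$ ($\kappa=0$ meaning no killing), has Laplace exponent $\psi$ given by $\mathbb{E}(e^{u\xi_t})=e^{\psi(u)t}$, $t\ge 0$, $u\ge0$, with $$\psi(u)=-\kappa+au+\tfrac12\sigma^2u^2+\int_{(-\infty,0)}\left(e^{ux}-1-ux\mathbf{1}_{(|x|<1)}\right)\Pi(dx),$$ where $a\in\mathbb{R}$, $\sigma^2\ge 0$ and $\Pi$ is a measure concentrated on $(-\infty,0)$ with $\int_{(-\infty,0)}(1\wedge x^2)\,\Pi(dx)<\infty$ (the case where $-\xi$ is a possibly killed subordinator is included). For $\ell\le 0$, $\Psi_\ell$ denotes the family of Laplace exponents of (possibly killed) Lévy processes with no positive jumps that are well defined on $(\ell,\infty)$. For $\psi\in\Psi_\ell$ and $\delta,\beta\ge 0$, with the additional constraint $\psi'(0+)=\psi(0)=0$ if $\beta=0$, define $$\mathcal{T}_{\delta,\beta}\psi(u)=\frac{u+\beta-\delta}{u+\beta}\,\psi(u+\beta)-\frac{\beta-\delta}{\beta}\,\psi(\beta),\quad u\ge-\beta.$$ Equivalently, with $\Phi(u)=\psi(u)/u$, $\mathcal{T}_{\delta,\beta}\psi(u)=[\psi(u+\beta)-\psi(\beta)]-\delta[\Phi(u+\beta)-\Phi(\beta)]$, where for $\beta=0$ one uses $\Phi(0+)=\psi'(0+)=0$.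
   Formalization: The last density is corrected from δ(κ/β)e^{βx}dx to δκe^{βx}dx (the printed one fails for ψ=−κ, β≠1), and when δκ>0 the class Ψ_{ℓ−β} is replaced by Ψ_{−β}, because the transform then has a pole at u=−β. *)

(* Defs.v *)
From HB Require Import structures.
From mathcomp Require Import all_boot all_order all_algebra.
From mathcomp Require Import all_classical all_reals all_analysis.
From mathcomp Require Import ring.

Set Implicit Arguments.
Unset Strict Implicit.
Unset Printing Implicit Defensive.

Import Order.TTheory GRing.Theory Num.Theory.
Import numFieldTopology.Exports numFieldNormedType.Exports.

Local Open Scope classical_set_scope.
Local Open Scope ring_scope.

Definition jump_measure (R : realType)
    (Pi : {measure set (measurableTypeR R) -> \bar R}) : Prop :=
  Pi `[0, +oo[%classic = 0%E /\
  (\int[Pi]_(x in `]-oo, 0%R[) (Num.min 1 (x ^+ 2))%:E < +oo)%E.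

Definition lk_integrand (R : realType) (u x : R) : R :=
  expR (u * x) - 1 - u * x * (`|x| < 1)%R%:R.

Definition lk_exponent (R : realType) (kappa a sigma : R)
    (Pi : {measure set (measurableTypeR R) -> \bar R}) (u : R) : R :=
  - kappa + a * u + sigma ^+ 2 / 2 * u ^+ 2
  + \int[Pi]_(x in `]-oo, 0[) lk_integrand u x.

(* [psi] is the Laplace exponent, well defined on ]ell, +oo[ (ell <= 0), of the
   Levy process with no positive jumps with killing rate [kappa], Gaussian
   coefficient [sigma] and jump measure [Pi], the process being described by its
   Levy-Khintchine characteristics.  Only the values of [psi] on
   ]ell, +oo[ U [0, +oo[ matter.  For a [jump_measure], integrability of
   [lk_integrand u] amounts to \int_(x <= -1) exp(u x) Pi(dx) < +oo, i.e. to
   E(exp(u xi_t)) < +oo. *)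
Definition laplace_exponent_of (R : realType) (ell kappa a sigma : R)
    (Pi : {measure set (measurableTypeR R) -> \bar R}) (psi : R -> R) : Prop :=
  [/\ 0 <= kappa, jump_measure Pi,
      forall u, ell < u ->
        Pi.-integrable `]-oo, 0[ (EFin \o lk_integrand u) &
      forall u, ell < u \/ 0 <= u -> psi u = lk_exponent kappa a sigma Pi u].

Definition Psi (R : realType) (ell : R) : set (R -> R) :=
  [set psi | exists kappa a sigma Pi,
     laplace_exponent_of ell kappa a sigma Pi psi].

(* psi(u) / u, continued to 0 by its right limit Phi(0+). *)
Definition Phi (R : realType) (psi : R -> R) (u : R) : R :=
  if u == 0 then lim (psi w / w @[w --> (0 : R)^'+]) else psi u / u.

(* When beta <> 0 and u + beta = 0, the quotient (u + beta - delta) / (u + beta)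
   is singular; this form gives the continuous extension of T at - beta. *)
Definition Ttrans (R : realType) (delta beta : R) (psi : R -> R) (u : R) : R :=
  (psi (u + beta) - psi beta) - delta * (Phi psi (u + beta) - Phi psi beta).

Lemma TtransE (R : realType) (delta beta : R) (psi : R -> R) (u : R) :
  beta != 0 -> u + beta != 0 ->
  Ttrans delta beta psi u =
  (u + beta - delta) / (u + beta) * psi (u + beta)
  - (beta - delta) / beta * psi beta.
Proof.
by move=> b0 ub0; rewrite /Ttrans /Phi (negbTE b0) (negbTE ub0); field; rewrite b0.
Qed.

Lemma Ttrans0E (R : realType) (delta : R) (psi : R -> R) (u : R) :
  psi 0 = 0 -> psi w / w @[w --> (0 : R)^'+] --> (0 : R) -> u != 0 ->
  Ttrans delta 0 psi u = (u - delta) / u * psi u.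
Proof.
move=> psi0 Phi0 u0; rewrite /Ttrans /Phi addr0 (negbTE u0) eqxx psi0.
by rewrite (cvg_lim _ Phi0)//; field.
Qed.

(* If delta > 0 and kappa = - psi 0 > 0, then [Ttrans delta beta psi] has a
   pole at - beta, coming from - delta Phi(u + beta) ~ delta kappa / (u + beta),
   even when [psi] is defined to the left of 0; so it is only well defined on
   (- beta, +oo).  E.g. psi = - kappa belongs to all the Psi_ell and is
   transformed into - delta kappa u / (beta (u + beta)).  In all other cases
   the left end point of the domain is translated by - beta. *)
Definition Ttrans_abscissa (R : realType) (ell delta : R) (psi : R -> R) : R :=
  if delta * psi 0 == 0 then ell else 0.

(* The measure exp(beta x) Pi(dx) + delta exp(beta x) Pi(-oo, x) dx
   + delta kappa exp(beta x) dx on ]-oo, 0[.  Killing acts as a jump to -oo of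
   rate kappa, i.e. as Pi(-oo, x) + kappa in place of Pi(-oo, x): the
   coefficient of the last density is delta kappa, since
     - delta kappa u / (beta (u + beta))
       = \int_(-oo, 0) (exp(u x) - 1) delta kappa exp(beta x) dx,
   the total mass of this component being delta kappa / beta. *)
Definition Ttrans_jump (R : realType) (delta beta kappa : R)
    (Pi : {measure set (measurableTypeR R) -> \bar R}) (A : set R) : \bar R :=
  (\int[Pi]_(x in A) (expR (beta * x))%:E
   + \int[lebesgue_measure]_(x in A)
       (delta%:E * (expR (beta * x))%:E * Pi `]-oo, x[%classic)
   + \int[lebesgue_measure]_(x in A) (delta * kappa * expR (beta * x))%:E)%E.

(* Main.v *)
Require Import Defs.
From HB Require Import structures.
From mathcomp Require Import all_boot all_order all_algebra.
From mathcomp Require Import all_classical all_reals all_analysis.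
From mathcomp Require Import measurable_realfun ring lra.

Set Implicit Arguments.
Unset Strict Implicit.
Unset Printing Implicit Defensive.

Import Order.TTheory GRing.Theory Num.Theory.
Import numFieldTopology.Exports numFieldNormedType.Exports.

Local Open Scope classical_set_scope.
Local Open Scope ring_scope.

(** Write [v = u + beta], let [psi] have killing rate [kappa], Gaussian
    coefficient [sigma], jump measure [Pi], and let [mu] be Lebesgue measure.
    The transform is the sum of two Laplace exponents.

    The difference [psi (u + beta) - psi beta] is the Esscher transform: the
    integrands satisfy, up to a multiple of [u] which goes into the drift,
      [lk (u + beta) x - lk beta x = lk u x * expR (beta * x)],
    so that [Pi] is tilted by [expR (beta * x)] and the killing cancels
    ([laplace_exponent_esscher]).

    For the other term, divide the Levy-Khintchine formula by its argument.  The
    jump part of [Phi v] is minus the integral over [Pi] of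
      [expint v y = \int[mu]_(x | y < x < 0) expR (v * x)],
    up to a constant that does not depend on [v], and its killing part is
    [- kappa / v], which is minus [kappa] times the same integral over
    [x < 0] ([PhiE]).  Hence [- (Phi v - Phi beta)] integrates
    [(expR (u * x) - 1) * expR (beta * x)] over [y < x < 0], first in [x], and
    then in [y] against [Pi], with an additional mass [kappa] at [y = -oo].
    Exchanging the integrals turns this into the exponent of a process of
    bounded variation without killing, whose jump measure has the density
      [expR (beta * x) * (Pi (-oo, x) + kappa)]
    ([Rintegral_tail_expRB1]).  Tonelli's theorem is enough for the exchange,
    because [expR (u * x) - 1] has a constant sign on [x < 0].  The Gaussian part
    of [- delta * (Phi v - Phi beta)] is linear in [u] and goes into the drift.

    The delicate point is that [expint 0 y = - y] must be integrable against
    the large jumps when [beta = 0] or when [u + beta = 0] is in the domain.  In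
    the second case [psi] is finite to the left of [0], so that the large jumps
    have exponential moments ([integrable_expint0_trunc]); in the first case a
    finite slope of [psi] at [0+] and Fatou's lemma give the integrability
    ([cvg_psi_div_integrable]).  When [u + beta = 0], the value of [Phi] at [0]
    is then computed by dominated convergence ([cvg_psi_div0]). *)

(** * Measures given by a density *)

Section density_measure.
Local Open Scope ereal_scope.
Context d (T : measurableType d) (R : realType).
Variables (mu : {measure set T -> \bar R}) (w : T -> R).
Hypotheses (mw : measurable_fun setT w) (w0 : forall x, (0 <= w x)%R).

(** The hypotheses on the density are arguments, because the measure structure
    on this set function is built from them. *)
Definition density_measure of measurable_fun setT w & (forall x, (0 <= w x)%R) :
  set T -> \bar R := fun A => \int[mu]_(x in A) (w x)%:E.

Local Notation nu := (density_measure mw w0).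

Let nu0 : nu set0 = 0. Proof. by rewrite /density_measure integral_set0. Qed.

Let nu_ge0 A : 0 <= nu A.
Proof. by apply: integral_ge0 => x _; rewrite lee_fin. Qed.

Let nu_sigma_additive : semi_sigma_additive nu.
Proof.
move=> /= F mF tF mUF; rewrite /density_measure; apply: cvg_toP.
  apply: ereal_nondecreasing_is_cvgn => m n mn.
  by apply: lee_sum_nneg_natr => // k _ _; exact: nu_ge0.
rewrite ge0_integral_bigcup//; first exact/measurable_EFinP/measurable_funTS.
by move=> x _; rewrite lee_fin.
Qed.

HB.instance Definition _ := isMeasure.Build _ _ _ nu
  nu0 nu_ge0 nu_sigma_additive.

Import HBNNSimple.

Let integral_density_nnsfun (D : set T) (f : {nnsfun T >-> R}) :
  measurable D ->
  \int[nu]_(x in D) (f x)%:E = \int[mu]_(x in D) ((f x)%:E * (w x)%:E).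
Proof.
move=> mD.
under [LHS]eq_integral do rewrite fimfunE -fsumEFin//.
rewrite [LHS]ge0_integral_fsum//; last 2 first.
  - by move=> r; apply/measurable_EFinP/measurable_funTS/measurableT_comp.
  - by move=> n x _; rewrite EFinM nnfun_muleindic_ge0.
under [RHS]eq_integral.
  move=> x xD; rewrite fimfunE -fsumEFin// ge0_mule_fsuml; last first.
    by move=> r; rewrite EFinM nnfun_muleindic_ge0.
  over.
rewrite [RHS]ge0_integral_fsum//; last 2 first.
  - move=> r; apply: emeasurable_funM; last exact/measurable_EFinP/measurable_funTS.
    by apply/measurable_EFinP/measurable_funTS/measurableT_comp.
  - by move=> n x _; apply: mule_ge0; rewrite ?EFinM ?nnfun_muleindic_ge0// lee_fin.
apply: eq_fsbigr => r _.
have mr : measurable (f @^-1` [set r]) by exact: measurable_funPTI.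
under [LHS]eq_integral do rewrite EFinM.
rewrite integralZl_indic_nnsfun// integral_indic//.
under [RHS]eq_integral do rewrite EFinM.
have [r0|r0] := ltP r 0%R.
  by rewrite preimage_nnfun0// set0I measure0 mule0; apply/esym/integral0_eq
    => x _; rewrite indic0 mule0 mul0e.
transitivity (r%:E * \int[mu]_(x in f @^-1` [set r] `&` D) (w x)%:E) => //.
under [RHS]eq_integral do rewrite -muleA.
rewrite ge0_integralZl//; last 2 first.
- apply: emeasurable_funM; last exact/measurable_EFinP/measurable_funTS.
  exact/measurable_EFinP/measurable_funTS.
- by move=> x _; rewrite mule_ge0 ?lee_fin// lee_fin.
rewrite setIC integral_mkcondr; congr (_ * _); apply: eq_integral => x _.
by rewrite patchE indicE; case: ifP => _; rewrite ?mul1e ?mul0e.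
Qed.

Lemma ge0_integral_density (D : set T) (f : T -> \bar R) : measurable D ->
  measurable_fun D f -> (forall x, D x -> 0 <= f x) ->
  \int[nu]_(x in D) f x = \int[mu]_(x in D) (f x * (w x)%:E).
Proof.
move=> mD mf f0.
pose h := nnsfun_approx mD mf.
have -> : \int[nu]_(x in D) f x = limn (fun n => \int[nu]_(x in D) (h n x)%:E).
  rewrite -monotone_convergence//=.
  - apply: eq_integral => x /[!inE] xD; apply/esym/cvg_lim => //=.
    exact: cvg_nnsfun_approx.
  - by move=> n; exact/measurable_EFinP/measurable_funTS.
  - by move=> n x _; rewrite lee_fin.
  - by move=> x _ a b ab; rewrite lee_fin; exact/lefP/nd_nnsfun_approx.
under eq_fun do rewrite integral_density_nnsfun//.
rewrite -monotone_convergence//=.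
- apply: eq_integral => x /[!inE] xD; apply/cvg_lim => //=.
  by apply: cvgeZr => //; exact: cvg_nnsfun_approx.
- move=> n; apply: emeasurable_funM; last exact/measurable_EFinP/measurable_funTS.
  exact/measurable_EFinP/measurable_funTS.
- by move=> n x _; rewrite mule_ge0 ?lee_fin// lee_fin.
- move=> x _ a b ab; apply: lee_wpmul2r; rewrite lee_fin//.
  exact/lefP/nd_nnsfun_approx.
Qed.

Lemma integral_density (D : set T) (f : T -> \bar R) : measurable D ->
  measurable_fun D f ->
  \int[nu]_(x in D) f x = \int[mu]_(x in D) (f x * (w x)%:E).
Proof.
move=> mD mf; rewrite [LHS]integralE [RHS]integralE.
rewrite !ge0_integral_density//; [|exact: measurable_funeneg
  |exact: measurable_funepos].
congr (_ - _); apply: eq_integral => x _.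
  by rewrite !funeposE maxe_pMl ?mul0e ?lee_fin.
by rewrite !funenegE maxe_pMl ?mul0e ?mulNe ?lee_fin.
Qed.

Lemma integrable_density (D : set T) (f : T -> \bar R) : measurable D ->
  measurable_fun D f -> mu.-integrable D (f \* (EFin \o w)) -> nu.-integrable D f.
Proof.
move=> mD mf /integrableP[_ ioo]; apply/integrableP; split => //.
rewrite ge0_integral_density//; last exact: measurableT_comp.
by under eq_integral do rewrite -[(w _)%:E]gee0_abs ?lee_fin// -abseM.
Qed.

End density_measure.

(** * Jump measures *)

Section jump_measure.
Context (R : realType).
Variable Pi : {measure set (measurableTypeR R) -> \bar R}.
Hypothesis jPi : jump_measure Pi.
Local Notation D := (`]-oo, (0 : R)[%classic : set (measurableTypeR R)).

(** Markov's inequality for [Num.min 1 (x ^+ 2)]. *)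
Lemma jump_measure_tail_lty (y : R) : y < 0 -> (Pi `]-oo, y[%classic < +oo)%E.
Proof.
move=> y0; have [_ ioo] := jPi.
have a0 : 0 < Num.min 1 (y ^+ 2) by rewrite lt_min ltr01 exprn_even_gt0//= lt_eqF.
have mm : measurable_fun D (fun x : measurableTypeR R => (Num.min 1 (x ^+ 2))%:E).
  apply/measurable_EFinP/measurable_funTS/measurable_minr => //.
have g0 x : (0 <= (Num.min 1 (x ^+ 2))%:E :> \bar R)%E.
  by rewrite lee_fin le_min ler01 sqr_ge0.
have := le_integral_abse Pi (measurable_itv _) mm a0.
under eq_integral do rewrite gee0_abs//.
move=> /le_lt_trans /(_ ioo) h.
apply: (@le_lt_trans _ _ (Pi (D `&` [set x | ((Num.min 1 (y ^+ 2))%:E <=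
    `|(Num.min 1 (x ^+ 2))%:E|)%E]))).
  apply: le_measure; rewrite ?inE//.
  - apply: emeasurable_fun_c_infty => //; exact: measurableT_comp.
  - move=> x /=; rewrite !in_itv/= => xy; split; first exact: lt_trans y0.
    rewrite lee_fin (ger0_norm (g0 x)) le_min !ge_min lexx/=; apply/orP; right.
    by nra.
rewrite ltNge leye_eq; apply/negP => /eqP moo.
by move: h; rewrite moo gt0_muley// ltxx.
Qed.

(** The null set [0 <= x] and the sets [x < - 1 / m], of finite measure, cover
    the line. *)
Lemma jump_measure_sigma_finite : sigma_finite setT Pi.
Proof.
exists (fun n => if n is m.+1 then `]-oo, - m.+1%:R^-1[%classic
                 else `[0, +oo[%classic).
  apply/esym; rewrite -subTset => x _ /=.
  have [x0|x0] := leP 0 x; first by exists 0%N => //=; rewrite in_itv/= x0.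
  exists (Num.truncn (- x)^-1).+1 => //=; rewrite in_itv/= ltrNr.
  rewrite invf_plt ?posrE ?oppr_gt0//.
  exact: truncnS_gt.
case=> [|m]; split => //; first by have [-> _] := jPi; exact: ltry.
by apply: jump_measure_tail_lty; rewrite oppr_lt0 invr_gt0.
Qed.

End jump_measure.

(** * Integrals of exponentials *)

Section expint.
Context (R : realType).
Local Notation mu := (@lebesgue_measure R).
Implicit Types v x y : R.

(** The integral of [expR (v * x)] over [y < x < 0].  It is continuous in [v], and
    its value at [v = 0] is the one that gives [Phi] at [0]. *)
Definition expint v y : R := if v == 0 then - y else (1 - expR (v * y)) / v.

Lemma expint0 v : expint v 0 = 0.
Proof. by rewrite /expint mulr0 expR0 subrr mul0r oppr0; case: ifP. Qed.

(** Differentiation in the lower end point of the integral. *)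
Lemma is_derive_expint v x : is_derive x 1 (expint v) (- expR (v * x)).
Proof.
rewrite /expint; have [->|v0] := eqVneq v 0.
  by rewrite mul0r expR0; apply: is_deriveN.
apply: is_derive_eq.
by rewrite scaler0 !add0r mul1r /GRing.scale/= mulr1 mulrN mulrCA mulVf ?mulr1//.
Qed.

Lemma continuous_expint v : continuous (expint v).
Proof.
move=> x; apply/differentiable_continuous/derivable1_diffP.
by have [] := is_derive_expint v x.
Qed.

Lemma continuous_expRM v : continuous (fun x => expR (v * x)).
Proof.
move=> x; apply: continuous_comp; last exact: continuous_expR.
exact: mulrl_continuous.
Qed.

Lemma measurable_expRM v (D : set (measurableTypeR R)) :
  measurable_fun D (fun x => expR (v * x)).
Proof.
apply: measurable_funTS; apply: measurableT_comp; first exact: measurable_expR.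
exact: mulrl_measurable.
Qed.

Lemma integral_expR_itv v y : y < 0 ->
  (\int[mu]_(x in `]y, 0%R[) (expR (v * x))%:E = (expint v y)%:E)%E.
Proof.
move=> y0.
have mf (D : set (measurableTypeR R)) : measurable_fun D (fun x => (expR (v * x))%:E).
  by apply/measurable_EFinP; apply: measurable_expRM.
rewrite integral_itv_obnd_cbnd; last exact: mf.
rewrite integral_itv_bndo_bndc; last exact: mf.
rewrite (@continuous_FTC2 _ _ (fun x => - expint v x))//.
- by rewrite expint0 oppr0 sub0e EFinN oppeK.
- by apply: continuous_subspaceT => x; exact: continuous_expRM.
- split.
  + by move=> z _; apply: derivableN; have [] := is_derive_expint v z.
  + by apply: cvg_at_right_filter; apply: cvgN; exact: continuous_expint.
  + by apply: cvg_at_left_filter; apply: cvgN; exact: continuous_expint.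
- move=> z _; have [dz ez] := is_derive_expint v z.
  by rewrite derive1E deriveN// ez opprK.
Qed.

Lemma integral_expR_Ny v : 0 < v ->
  (\int[mu]_(x in `]-oo, 0%R[) (expR (v * x))%:E = v^-1%:E)%E.
Proof.
move=> v0.
have mf (D : set (measurableTypeR R)) : measurable_fun D (fun x => (expR (v * x))%:E).
  by apply/measurable_EFinP; apply: measurable_expRM.
have dF x : is_derive x 1 (expint v \o -%R) (expR (v * - x)).
  apply: (is_derive_eq (is_derive1_comp _ _)); first exact: is_derive_expint.
  by rewrite mulrN1 opprK.
have cF : continuous (expint v \o -%R).
  by move=> x; apply: continuous_comp; [exact: opp_continuous|
    exact: continuous_expint].
rewrite integral_itv_bndo_bndc; last exact: mf.
have -> : `]-oo, (0 : R)]%classic = `]-oo, (- 0 : R)]%classic by rewrite oppr0.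
rewrite ge0_integration_by_substitutionNy; last 2 first.
- by apply: continuous_subspaceT => x; exact: continuous_expRM.
- by move=> x _; exact: expR_ge0.
rewrite (@ge0_continuous_FTC2y _ _ (expint v \o -%R) _ v^-1)//.
- by rewrite /= oppr0 expint0 sube0.
- by move=> x _; exact: expR_ge0.
- apply: continuous_subspaceT => x; apply: continuous_comp.
    exact: opp_continuous.
  exact: continuous_expRM.
- rewrite (_ : expint v \o -%R = fun x => (1 - expR (- (v * x))) * v^-1).
    have lE : v^-1 = (1 - 0) * v^-1 by rewrite subr0 mul1r.
    rewrite [X in _ --> X]lE {lE}.
    apply: cvgM; last exact: cvg_cst.
    apply: (@cvgB _ R^o); first exact: cvg_cst.
    apply: (@cvg_comp _ _ _ (fun x => v * x) (fun x => expR (- x)) _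
      (pinfty_nbhs R)); first exact: gt0_cvgMry.
    exact: cvgr_expR.
  by apply/funext => x; rewrite /expint/= gt_eqF// mulrN.
- by apply: cvg_at_right_filter; exact: cF.
- by move=> x _; rewrite derive1E; have [_ ->] := dF x.
Qed.

End expint.

(** The factor [s] stands for the sign of [expR (u * x) - 1]; with it the
    integrand is nonnegative when [S] is contained in [x < 0]. *)
Lemma integral_expRB1 (R : realType) (S : set (measurableTypeR R))
    (s u b p q : R) : measurable S ->
  (\int[lebesgue_measure]_(x in S) (expR ((u + b) * x))%:E = p%:E)%E ->
  (\int[lebesgue_measure]_(x in S) (expR (b * x))%:E = q%:E)%E ->
  (\int[lebesgue_measure]_(x in S) (s * (expR (u * x) - 1) * expR (b * x))%:E =
   (s * (p - q))%:E)%E.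
Proof.
move=> mS ip iq.
have ie v r : (\int[lebesgue_measure]_(x in S) (expR (v * x))%:E = r%:E)%E ->
    lebesgue_measure.-integrable S (EFin \o (fun x => expR (v * x))).
  move=> ir; apply/integrableP; split.
    by apply/measurable_EFinP; apply: measurable_expRM.
  under eq_integral do rewrite /= ger0_norm ?expR_ge0//.
  by rewrite ir ltry.
rewrite EFinM EFinB -ip -iq -integralB_EFin; [|by []|exact: ie ip|exact: ie iq].
rewrite -integralZl//; last exact: integrableB (ie _ _ ip) (ie _ _ iq).
apply: eq_integral => x _.
by rewrite -EFinB -EFinM -mulrA mulrBl mul1r -expRD -mulrDl.
Qed.

(** * Tonelli formula for the tail of a measure *)

Section sigma_finite_copy.
Context d (T : measurableType d) (R : realType).
Variable mu : {measure set T -> \bar R}.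
Hypothesis sf : sigma_finite setT mu.

(** Product measures expect the sigma-finiteness to be part of the measure,
    whereas it is a proposition for the jump measures considered here. *)
Definition sigma_finite_copy of sigma_finite setT mu : set T -> \bar R := mu.

HB.instance Definition _ := Measure.copy (sigma_finite_copy sf) mu.
HB.instance Definition _ :=
  Measure_isSigmaFinite.Build _ _ _ (sigma_finite_copy sf) sf.

Lemma sigma_finite_copyE (D : set T) (f : T -> \bar R) :
  (\int[sigma_finite_copy sf]_(x in D) f x = \int[mu]_(x in D) f x)%E.
Proof. exact: eq_measure_integral. Qed.

End sigma_finite_copy.

Section tail.
Local Open Scope ereal_scope.
Context (R : realType).
Variable Pi : {measure set (measurableTypeR R) -> \bar R}.
Hypothesis sf : sigma_finite setT Pi.
Local Notation mu := (@lebesgue_measure R).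
Local Notation D := (`]-oo, (0 : R)%R[%classic : set (measurableTypeR R)).
Local Notation RR := (measurableTypeR R).

Let below : set (RR * RR) := [set z | (z.2 < z.1)%R].

Let mbelow : measurable below.
Proof.
rewrite [below](_ : _ = setT `&` [set z | z.2%:E < z.1%:E]).
  by apply: measurable_lte => //; apply/measurable_EFinP;
    [exact: measurable_snd|exact: measurable_fst].
by rewrite setTI; apply/seteqP; split => z; rewrite /below/= lte_fin.
Qed.

Let integral_below x : \int[Pi]_y (\1_below (x, y))%:E = Pi `]-oo, x[%classic.
Proof.
transitivity (\int[Pi]_y (\1_(`]-oo, x[%classic : set RR) y)%:E); last first.
  by rewrite integral_indic// setIT.
apply: eq_integral => y _; rewrite !indicE; congr (_%:R%:E).
Qed.

Lemma measurable_tail : measurable_fun setT (fun x : RR => Pi `]-oo, x[%classic).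
Proof.
have m1 : measurable_fun setT (fun z : RR * RR => (\1_below z)%:E : \bar R).
  exact/measurable_EFinP/measurable_indic.
have := @measurable_fun_fubini_tonelli_F _ _ _ _ _ (sigma_finite_copy sf) _ m1.
have f0 z : 0 <= (\1_below z)%:E :> \bar R by rewrite lee_fin.
move=> /(_ f0); apply: eq_measurable_fun => x _; rewrite /fubini_F (sigma_finite_copyE sf).
exact: integral_below.
Qed.

(** Both sides integrate [g x] over the wedge [y < x < 0], in [x] against the
    Lebesgue measure and in [y] against [Pi]. *)
Lemma integral_tail (g : RR -> \bar R) :
  measurable_fun D g -> (forall x, D x -> 0 <= g x) ->
  \int[mu]_(x in D) (g x * Pi `]-oo, x[%classic) =
  \int[Pi]_(y in D) \int[mu]_(x in `]y, 0%R[) g x.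
Proof.
move=> mg g0; pose f (z : RR * RR) := (g \_ D) z.1 * (\1_below z)%:E.
have mf : measurable_fun setT f.
  apply: emeasurable_funM; last exact/measurable_EFinP/measurable_indic.
  apply: measurableT_comp measurable_fst => //.
  have mD : measurable D by [].
  exact: (measurable_restrictT g mD).1 mg.
have f0 z : 0 <= f z.
  by apply: mule_ge0; [apply: erestrict_ge0|rewrite lee_fin].
have := @fubini_tonelli _ _ _ _ _ mu (sigma_finite_copy sf) f mf f0.
rewrite (sigma_finite_copyE sf) => FT.
transitivity (\int[mu]_x \int[sigma_finite_copy sf]_y f (x, y)).
  rewrite integral_mkcond; apply: eq_integral => x _.
  rewrite (sigma_finite_copyE sf) /f/= ge0_integralZl//; last 2 first.
  - apply/measurable_EFinP; apply: (measurableT_comp (measurable_indic mbelow)).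
    exact: measurable_pair1.
  - by apply: erestrict_ge0.
  rewrite !patchE; case: ifPn => xD; last by rewrite mul0e.
  by congr (_ * _); exact/esym/integral_below.
rewrite FT [RHS]integral_mkcond; apply: eq_integral => y _.
rewrite patchE; case: ifPn => yD.
  rewrite [RHS]integral_mkcond; apply: eq_integral => x _; rewrite /f/= !patchE.
  rewrite indicE.
  have -> : (x \in `]y, 0%R[%classic) = (x \in D) && ((x, y) \in below).
    by apply/idP/andP; rewrite !inE/= !in_itv/= andbC => /andP.
  case: (x \in D) => /=; last by rewrite mul0e.
  by case: (_ \in below); rewrite ?mule1// mule0.
apply: integral0_eq => x _; rewrite /f/= patchE indicE.
case: ifPn => xD; last by rewrite mul0e.
rewrite memNset ?mule0// => xy; move/negP: yD; apply.
by move: xD; rewrite !inE/= !in_itv/=; exact: lt_trans.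
Qed.

End tail.

(** * The jump measure produced by the quotient [psi u / u] *)

Section tail_measure.
Local Open Scope ereal_scope.
Context (R : realType).
Variables (delta beta kappa : R) (Pi : {measure set (measurableTypeR R) -> \bar R}).
Hypotheses (delta_ge0 : (0 <= delta)%R) (kappa_ge0 : (0 <= kappa)%R).
Hypothesis jPi : jump_measure Pi.
Local Notation mu := (@lebesgue_measure R).
Local Notation D := (`]-oo, (0 : R)%R[%classic : set (measurableTypeR R)).

(** A killing of rate [kappa] acts as a jump to [-oo] of rate [kappa]: it adds
    [kappa] to all the tails.  The restriction to [x < 0] keeps the tails
    finite, so that [fine] loses nothing. *)
Definition tail_density : measurableTypeR R -> R :=
  (fun x => delta * expR (beta * x) * (fine (Pi `]-oo, x[%classic) + kappa))%R
  \_ D.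

Lemma measurable_tail_density : measurable_fun setT tail_density.
Proof.
have mD : measurable D by [].
apply: (measurable_restrictT _ mD).1; apply: measurable_funM.
  by apply: measurable_funM => //; apply: measurable_expRM.
apply: measurable_funD => //; apply: measurable_funTS.
apply: measurableT_comp => //.
by apply: measurable_tail; exact: jump_measure_sigma_finite.
Qed.

Lemma tail_density_ge0 x : (0 <= tail_density x)%R.
Proof.
apply: restrict_ge0 => y _.
by rewrite !mulr_ge0 ?expR_ge0 ?addr_ge0 ?fine_ge0.
Qed.

Definition tail_measure : {measure set (measurableTypeR R) -> \bar R} :=
  density_measure mu measurable_tail_density tail_density_ge0.

Let tail_fin_num x : D x -> Pi `]-oo, x[%classic \is a fin_num.
Proof.
rewrite /= in_itv/= => x0; rewrite ge0_fin_numE//.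
exact: jump_measure_tail_lty.
Qed.

Lemma tail_densityE x : D x -> (tail_density x)%:E =
  delta%:E * (expR (beta * x))%:E * Pi `]-oo, x[%classic
  + (delta * kappa * expR (beta * x))%:E.
Proof.
move=> Dx; rewrite /tail_density patchE mem_set// mulrDr EFinD.
congr (_ + _); last by rewrite mulrAC.
by rewrite 2!EFinM fineK// tail_fin_num.
Qed.

Lemma tail_measureE A : measurable A -> A `<=` D ->
  tail_measure A =
  \int[mu]_(x in A)
     (delta%:E * (expR (beta * x))%:E * Pi `]-oo, x[%classic)
  + \int[mu]_(x in A) (delta * kappa * expR (beta * x))%:E.
Proof.
move=> mA AD; rewrite -ge0_integralD//=.
- by apply: eq_integral => x /[!inE]/AD; exact: tail_densityE.
- by move=> x _; rewrite !mule_ge0// lee_fin expR_ge0.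
- apply: emeasurable_funM.
    by apply: emeasurable_funM => //; apply/measurable_EFinP; apply: measurable_expRM.
  apply: measurable_funTS; apply: measurable_tail.
  exact: jump_measure_sigma_finite.
- by move=> x _; rewrite lee_fin !mulr_ge0// expR_ge0.
- by apply/measurable_EFinP; apply: measurable_funM => //; apply: measurable_expRM.
Qed.

Lemma tail_measure_itvcy : tail_measure `[0%R, +oo[%classic = 0.
Proof.
apply: integral0_eq => x; rewrite /= in_itv/= andbT => x0.
by rewrite /tail_density patchE memNset//= in_itv/= ltNge x0.
Qed.

(** The Tonelli formula, where the second term is the contribution of the
    additional mass [kappa] at [-oo]. *)
Lemma ge0_integral_tail_measure (g : measurableTypeR R -> R) :
  measurable_fun D g -> (forall x, D x -> 0 <= g x)%R ->
  \int[tail_measure]_(x in D) (g x)%:E =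
  delta%:E * (\int[Pi]_(y in D) \int[mu]_(x in `]y, 0%R[)
                (g x * expR (beta * x))%:E
              + kappa%:E * \int[mu]_(x in D) (g x * expR (beta * x))%:E).
Proof.
move=> mg g0.
have mge : measurable_fun D (fun x => (g x * expR (beta * x))%:E).
  by apply/measurable_EFinP; apply: measurable_funM => //; apply: measurable_expRM.
have ge0 x : D x -> 0 <= (g x * expR (beta * x))%:E.
  by move=> /g0 gx; rewrite lee_fin mulr_ge0// expR_ge0.
have mt := measurable_tail (jump_measure_sigma_finite jPi).
rewrite ge0_integral_density//; [|exact/measurable_EFinP].
rewrite -integral_tail//; last exact: jump_measure_sigma_finite.
rewrite -[X in _ * (_ + X)]ge0_integralZl// -ge0_integralD//; last 4 first.
- by move=> x Dx; rewrite mule_ge0// ge0.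
- exact: emeasurable_funM (measurable_funTS mt).
- by move=> x Dx; rewrite mule_ge0// ge0.
- exact: emeasurable_funM.
rewrite -ge0_integralZl//; last 2 first.
- apply: emeasurable_funD; last exact: emeasurable_funM.
  exact: emeasurable_funM (measurable_funTS mt).
- by move=> x Dx; rewrite adde_ge0// mule_ge0// ge0.
apply: eq_integral => x /[!inE] Dx; rewrite tail_densityE//.
by rewrite -(fineK (tail_fin_num Dx)) -!EFinM; congr EFin; ring.
Qed.

Section expRB1.
Variable u : R.
Hypothesis iE : Pi.-integrable D
  (EFin \o (fun x => expint (u + beta) x - expint beta x))%R.
Hypothesis kE : kappa = 0%R \/ (0 < beta /\ 0 < u + beta)%R.

(** The function [expR (u * x) - 1] has this constant sign on [x < 0], so that the
    Tonelli formula for nonnegative functions applies. *)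
Let s : R := (if u <= 0 then 1 else -1)%R.

Let ss : (s * s = 1)%R.
Proof. by rewrite /s; case: ifP => _; rewrite ?mulr1 ?mulrNN ?mulr1. Qed.

Let sge0 x : D x -> (0 <= s * (expR (u * x) - 1))%R.
Proof.
rewrite /= in_itv/= => x0; rewrite /s; case: ifP => u0.
  by rewrite mul1r subr_ge0 -expR0 ler_expR; nra.
rewrite mulN1r oppr_ge0 subr_le0 -expR0 ler_expR.
by move/negbT: u0; rewrite -ltNge => u0; nra.
Qed.

Let integral_signed : \int[tail_measure]_(x in D) (s * (expR (u * x) - 1))%:E =
  (s * (delta * (kappa * ((u + beta)^-1 - beta^-1)
   + \int[Pi]_(x in D) (expint (u + beta) x - expint beta x))))%:E.
Proof.
have mg : measurable_fun D (fun x => s * (expR (u * x) - 1))%R.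
  apply: measurable_funM => //; apply: measurable_funB => //.
  exact: measurable_expRM.
rewrite ge0_integral_tail_measure//.
rewrite (eq_integral (fun y : measurableTypeR R =>
    s%:E * (expint (u + beta) y - expint beta y)%:E)); last first.
  move=> y /[!inE]; rewrite /= in_itv/= => y0.
  by rewrite (integral_expRB1 _ _ (integral_expR_itv _ y0)
    (integral_expR_itv _ y0)).
rewrite integralZl// -[\int[Pi]_(x in D) _]fineK; last first.
  exact: integrable_fin_num iE.
rewrite -/(Rintegral _ _ _).
have -> : kappa%:E * \int[mu]_(x in D) (s * (expR (u * x) - 1)
    * expR (beta * x))%:E = (kappa * (s * ((u + beta)^-1 - beta^-1)))%:E.
  have [->|[b0 v0]] := kE; first by rewrite mul0e mul0r.
  by rewrite (integral_expRB1 _ _ (integral_expR_Ny v0) (integral_expR_Ny b0)).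
by rewrite -!EFinM; congr EFin; rewrite -/(Rintegral _ _ _); ring.
Qed.

Lemma integrable_tail_expRB1 :
  tail_measure.-integrable D (EFin \o (fun x => expR (u * x) - 1))%R.
Proof.
apply/integrableP; split.
  apply/measurable_EFinP; apply: measurable_funB => //.
  exact: measurable_expRM.
rewrite (eq_integral (fun x : measurableTypeR R => (s * (expR (u * x) - 1))%:E)).
  by rewrite integral_signed ltry.
move=> x /[!inE] Dx; rewrite /= -[in RHS](ger0_norm (sge0 Dx)) normrM.
by rewrite -[(`|s|)%R](@sqrtr_sqr _ s) expr2 ss sqrtr1 mul1r.
Qed.

(** The inner integrals of the Tonelli formula are differences of [expint] on
    [y < x < 0] and of inverses on [x < 0].  If [kappa = 0], the latter may be infinite but
    is multiplied by [0]. *)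
Lemma Rintegral_tail_expRB1 :
  (\int[tail_measure]_(x in D) (expR (u * x) - 1) =
   delta * (kappa * ((u + beta)^-1 - beta^-1)
   + \int[Pi]_(x in D) (expint (u + beta) x - expint beta x)))%R.
Proof.
have /(congr1 (fun z => s * fine z)%R) := integral_signed.
rewrite -/(Rintegral _ _ _) RintegralZl//; last exact: integrable_tail_expRB1.
by rewrite /= !mulrA ss !mul1r.
Qed.

End expRB1.

End tail_measure.

(** * The Levy-Khintchine integrand *)

Section lk_integrand.
Context (R : realType).
Implicit Types u v w x b t e : R.

Definition trunc x : R := x * (`|x| < 1)%R%:R.

Lemma trunc_small x : x < 0 -> -1 < x -> trunc x = x.
Proof. by move=> x0 x1; rewrite /trunc ltr0_norm// ltrNl x1 mulr1. Qed.

Lemma trunc_big x : x <= -1 -> trunc x = 0.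
Proof.
move=> x1; rewrite /trunc ltr0_norm; last by rewrite (le_lt_trans x1)// oppr_lt0.
by rewrite ltrNl ltNge x1 mulr0.
Qed.

Lemma lk_integrandE u x : lk_integrand u x = expR (u * x) - 1 - u * trunc x.
Proof. by rewrite /lk_integrand /trunc mulrA. Qed.

Lemma lk_integrand0 x : lk_integrand 0 x = 0.
Proof. by rewrite lk_integrandE !mul0r expR0 !subrr. Qed.

Lemma expRN_le_inv t : 0 <= t -> expR (- t) <= (1 + t)^-1.
Proof.
move=> t0; have t1 : 0 < 1 + t by rewrite ltr_pwDl.
rewrite expRN lef_pV2 ?posrE//; [exact: expR_ge1Dx|exact: expR_gt0].
Qed.

(** The lower bound comes from [(1 + t) * (1 - t + t ^+ 2) = 1 + t ^+ 3 >= 1]. *)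
Lemma onem_expRN_bounds t : 0 <= t -> t - t ^+ 2 <= 1 - expR (- t) <= t.
Proof.
move=> t0; apply/andP; split; last by have := expR_ge1Dx (- t); lra.
suff : expR (- t) <= 1 - t + t ^+ 2 by lra.
apply: (le_trans (expRN_le_inv t0)).
have t1 : 0 < 1 + t by rewrite ltr_pwDl.
rewrite -(ler_pM2l t1) mulfV ?gt_eqF//.
have : 0 <= t ^+ 3 by rewrite exprn_ge0.
nra.
Qed.

Lemma expint_le w x : 0 < w -> x < 0 -> - x - w * x ^+ 2 <= expint w x <= - x.
Proof.
move=> w0 x0; rewrite /expint gt_eqF//.
have /onem_expRN_bounds : 0 <= - (w * x) by rewrite oppr_ge0; nra.
rewrite opprK ler_pdivrMr// ler_pdivlMr//; set e := expR _.
by move=> /andP[h1 h2]; apply/andP; split; nra.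
Qed.

(** Dividing the Levy-Khintchine integrand by [- v] gives the left-hand side,
    which also makes sense at [v = 0], where it vanishes on the small jumps. *)
Lemma expint_trunc v x : v != 0 ->
  expint v x + trunc x = - v^-1 * lk_integrand v x.
Proof.
by move=> v0; rewrite /expint (negbTE v0) lk_integrandE; field.
Qed.

Lemma minr_sqr_ge0 x : 0 <= Num.min 1 (x ^+ 2).
Proof. by rewrite le_min ler01 sqr_ge0. Qed.

Lemma expint_trunc_bounds w x : 0 < w <= 1 -> x < 0 ->
  - Num.min 1 (x ^+ 2) <= expint w x + trunc x <= expint 0 x + trunc x.
Proof.
move=> /andP[w0 w1] x0; have /andP[h1 h2] := expint_le w0 x0.
rewrite [expint 0 x]/expint eqxx lerD2r h2 andbT.
have [x1|x1] := leP x (-1).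
  rewrite trunc_big// addr0 (@le_trans _ _ 0) ?oppr_le0 ?minr_sqr_ge0//.
  by rewrite /expint gt_eqF// divr_ge0 ?(ltW w0)// subr_ge0 -expR0 ler_expR; nra.
have -> : Num.min 1 (x ^+ 2) = x ^+ 2 by apply/min_idPr; nra.
by rewrite trunc_small//; nra.
Qed.

Lemma expint0_trunc_ge0 x : x < 0 -> 0 <= expint 0 x + trunc x.
Proof.
move=> x0; rewrite /expint eqxx; have [x1|x1] := leP x (-1).
  by rewrite trunc_big//; lra.
by rewrite trunc_small// addNr.
Qed.

Lemma normr_expint_trunc_le w x : 0 < w <= 1 -> x < 0 ->
  `|expint w x + trunc x| <= Num.min 1 (x ^+ 2) + (expint 0 x + trunc x).
Proof.
move=> w01 x0; have /andP[h1 h2] := expint_trunc_bounds w01 x0.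
have h3 := minr_sqr_ge0 x; have h4 := expint0_trunc_ge0 x0.
by rewrite ler_norml; apply/andP; split; lra.
Qed.

(** An exponential moment of negative order [- e] dominates the first moment of
    the large jumps. *)
Lemma expint0_trunc_le e x : 0 < e -> x < 0 ->
  expint 0 x + trunc x <= e^-1 * lk_integrand (- e) x.
Proof.
move=> e0 x0; rewrite /expint eqxx -(ler_pM2l e0) mulrA mulfV ?gt_eqF// mul1r.
rewrite lk_integrandE; have := expR_ge1Dx (- e * x).
have [x1|x1] := leP x (-1).
  by rewrite trunc_big//; nra.
by rewrite trunc_small// addNr; nra.
Qed.

(** The integrability of [1 - expR x] characterizes the jump measures of
    bounded variation; it is stronger than that of [Num.min 1 (x ^+ 2)], and it
    makes the compensation of the small jumps integrable.  The constant comes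
    from [1 - expR x >= - x / (1 - x)]. *)
Lemma minr_sqr_le_expRB1 x : x < 0 ->
  Num.min 1 (x ^+ 2) <= 2 * (1 - expR x).
Proof.
move=> x0; have : expR x <= (1 - x)^-1.
  by have := @expRN_le_inv (- x); rewrite opprK; apply; rewrite oppr_ge0 ltW.
have x1 : 0 < 1 - x by lra.
set e := expR x => h.
have h' : e * (1 - x) <= 1 by rewrite -ler_pdivlMr// mul1r.
have [xx|xx] := leP x (-1).
  apply: (@le_trans _ _ 1); first by rewrite ge_min lexx.
  by nra.
apply: (@le_trans _ _ (x ^+ 2)); first by rewrite ge_min lexx orbT.
by nra.
Qed.

Lemma normr_trunc_le_expRB1 x : x < 0 -> `|trunc x| <= 2 * (1 - expR x).
Proof.
move=> x0; have : expR x <= (1 - x)^-1.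
  by have := @expRN_le_inv (- x); rewrite opprK; apply; rewrite oppr_ge0 ltW.
have x1 : 0 < 1 - x by lra.
set e := expR x => h.
have h' : e * (1 - x) <= 1 by rewrite -ler_pdivlMr// mul1r.
have e1 : e <= 1 by rewrite /e -expR0 ler_expR ltW.
have [xx|xx] := leP x (-1); first by rewrite trunc_big// normr0; lra.
by rewrite trunc_small// ltr0_norm//; nra.
Qed.

(** Tilting changes the compensation of the small jumps by a term of second
    order. *)
Lemma normr_trunc_expRB1_le b x : 0 <= b -> x < 0 ->
  `|trunc x * (expR (b * x) - 1)| <= b * Num.min 1 (x ^+ 2).
Proof.
move=> b0 x0; have [xx|xx] := leP x (-1).
  by rewrite trunc_big// mul0r normr0 mulr_ge0// minr_sqr_ge0.
have := expR_ge1Dx (b * x).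
have : expR (b * x) <= 1 by rewrite -expR0 ler_expR; nra.
set e := expR _ => e1 e2.
have -> : Num.min 1 (x ^+ 2) = x ^+ 2 by apply/min_idPr; nra.
rewrite trunc_small// ger0_norm; nra.
Qed.

Lemma measurable_trunc (A : set (measurableTypeR R)) : measurable_fun A trunc.
Proof.
rewrite (_ : trunc = fun x => x * \1_(`]-1, 1[%classic : set R) x).
  by apply: measurable_funM => //; exact: measurable_indic.
by apply/funext => x; rewrite indicE mem_setE in_itv/= -ltr_norml.
Qed.

Lemma measurable_expint v (A : set (measurableTypeR R)) :
  measurable_fun A (expint v).
Proof.
apply: measurable_funTS; rewrite /expint; case: (v == 0).
  exact: measurableT_comp.
apply: measurable_funM => //; apply: measurable_funB => //.
exact: measurable_expRM.
Qed.

Lemma measurable_lk_integrand u (A : set (measurableTypeR R)) :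
  measurable_fun A (lk_integrand u).
Proof.
rewrite (funext (lk_integrandE u)).
apply: measurable_funB; last first.
  by apply: measurable_funM => //; exact: measurable_trunc.
by apply: measurable_funB => //; exact: measurable_expRM.
Qed.

End lk_integrand.

(** * Integrability of real-valued functions *)

Lemma le_integrable_EFin d (T : measurableType d) (R : realType)
    (mu : {measure set T -> \bar R}) (D : set T) (f g : T -> R) :
  measurable D -> measurable_fun D f -> (forall x, D x -> `|f x| <= g x) ->
  mu.-integrable D (EFin \o g) -> mu.-integrable D (EFin \o f).
Proof.
move=> mD mf fg; apply: le_integrable => //; first exact/measurable_EFinP.
by move=> x Dx; rewrite /= lee_fin (le_trans (fg _ Dx))// ler_norm.
Qed.

Section integrable_EFin.
Context d (T : measurableType d) (R : realType).
Variables (mu : {measure set T -> \bar R}) (D : set T) (mD : measurable D).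
Implicit Types f g : T -> R.

Lemma integrableD_EFin f g :
  mu.-integrable D (EFin \o f) -> mu.-integrable D (EFin \o g) ->
  mu.-integrable D (EFin \o (fun x => f x + g x)).
Proof. by move=> fi gi; exact: (integrableD mD fi gi). Qed.

Lemma integrableB_EFin f g :
  mu.-integrable D (EFin \o f) -> mu.-integrable D (EFin \o g) ->
  mu.-integrable D (EFin \o (fun x => f x - g x)).
Proof. by move=> fi gi; exact: (integrableB mD fi gi). Qed.

Lemma integrableZl_EFin c f : mu.-integrable D (EFin \o f) ->
  mu.-integrable D (EFin \o (fun x => c * f x)).
Proof. by move=> fi; exact: (integrableZl mD c fi). Qed.

End integrable_EFin.

Lemma integrable_minr_sqr (R : realType)
    (Pi : {measure set (measurableTypeR R) -> \bar R}) :
  jump_measure Pi ->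
  Pi.-integrable `]-oo, 0[ (EFin \o (fun x => Num.min 1 (x ^+ 2))).
Proof.
move=> [_ ioo]; apply/integrableP; split.
  apply/measurable_EFinP/measurable_funTS/measurable_minr => //.
by under eq_integral do rewrite /= ger0_norm ?minr_sqr_ge0//.
Qed.

(** At [u = 0], which is not greater than [ell] if [ell = 0], the integrand
    vanishes. *)
Lemma lk_integrable (R : realType) (ell kappa a sigma : R)
    (Pi : {measure set (measurableTypeR R) -> \bar R}) (psi : R -> R) u :
  ell <= 0 -> laplace_exponent_of ell kappa a sigma Pi psi ->
  ell < u \/ 0 <= u ->
  Pi.-integrable `]-oo, 0[ (EFin \o lk_integrand u).
Proof.
move=> l0 [_ _ ipsi _] [|]; first exact: ipsi.
rewrite le_eqVlt => /predU1P[<-|u0]; last exact/ipsi/(le_lt_trans l0).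
rewrite (_ : _ \o _ = cst 0%E); first exact: integrable0.
by apply/funext => x; rewrite /= lk_integrand0.
Qed.

(** * Exponential tilting *)

Section esscher.
Context (R : realType).
Variables (b : R) (Pi : {measure set (measurableTypeR R) -> \bar R}).
Hypotheses (b0 : 0 <= b) (jPi : jump_measure Pi).
Local Notation D := (`]-oo, (0 : R)[%classic : set (measurableTypeR R)).

Definition esscher_measure : {measure set (measurableTypeR R) -> \bar R} :=
  density_measure Pi (measurable_expRM b (D := setT))
    (fun x => expR_ge0 (b * x)).

Lemma jump_measure_esscher : jump_measure esscher_measure.
Proof.
have [Pi0 ioo] := jPi; split.
  apply: null_set_integral => //.
  by apply/measurable_EFinP; apply: measurable_expRM.
rewrite ge0_integral_density//; last 2 first.
- exact: measurable_int (integrable_minr_sqr jPi).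
- by move=> x _; rewrite lee_fin minr_sqr_ge0.
apply: le_lt_trans ioo; apply: ge0_le_integral => //.
- by move=> x _; rewrite -EFinM lee_fin mulr_ge0 ?minr_sqr_ge0 ?expR_ge0.
- apply: emeasurable_funM.
    exact: measurable_int (integrable_minr_sqr jPi).
  by apply/measurable_EFinP; apply: measurable_expRM.
- exact: measurable_int (integrable_minr_sqr jPi).
- move=> x; rewrite /= in_itv/= => x0; rewrite -EFinM lee_fin.
  by rewrite ler_piMr ?minr_sqr_ge0// -expR0 ler_expR mulr_ge0_le0// ltW.
Qed.

Lemma integrable_trunc_expRB1 :
  Pi.-integrable D (EFin \o (fun x => trunc x * (expR (b * x) - 1))).
Proof.
apply: (@le_integrable_EFin _ _ _ _ _ _
  (fun x : measurableTypeR R => b * Num.min 1 (x ^+ 2))) => //.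
- apply: measurable_funM; first exact: measurable_trunc.
  by apply: measurable_funB => //; exact: measurable_expRM.
- by move=> x; rewrite /= in_itv/= => x0; exact: normr_trunc_expRB1_le.
- by apply: integrableZl_EFin => //; exact: integrable_minr_sqr.
Qed.

(** The last term is the change of compensation, linear in [u]: it accounts for
    the integral in the drift of the tilted process. *)
Lemma lk_integrand_esscher u x :
  lk_integrand u x * expR (b * x) =
  lk_integrand (u + b) x - lk_integrand b x
  - u * (trunc x * (expR (b * x) - 1)).
Proof. by rewrite !lk_integrandE [((u + b) * x)]mulrDl expRD; ring. Qed.

Lemma laplace_exponent_esscher ell kappa a sigma psi : ell <= 0 ->
  laplace_exponent_of ell kappa a sigma Pi psi ->
  laplace_exponent_of (ell - b) 0
    (a + sigma ^+ 2 * b + \int[Pi]_(x in D) (trunc x * (expR (b * x) - 1)))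
    sigma esscher_measure (fun u => psi (u + b) - psi b).
Proof.
move=> l0 hpsi; have [k0 _ _ psiE] := hpsi.
have ib : Pi.-integrable D (EFin \o lk_integrand b).
  by apply: lk_integrable hpsi _ => //; right.
have it := integrable_trunc_expRB1.
have iv u : ell - b < u \/ 0 <= u ->
    Pi.-integrable D (EFin \o lk_integrand (u + b)).
  move=> hu; apply: lk_integrable hpsi _ => //.
  by case: hu => hu; [left; rewrite -ltrBlDr|right; rewrite addr_ge0].
have iu u : ell - b < u \/ 0 <= u -> Pi.-integrable D
    (EFin \o (fun x => lk_integrand u x * expR (b * x))).
  move=> /iv hu; rewrite (funext (lk_integrand_esscher u)).
  apply: integrableB_EFin => //; first exact: integrableB_EFin.
  exact: integrableZl_EFin.
have me u : measurable_fun D (EFin \o lk_integrand u).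
  by apply/measurable_EFinP; apply: measurable_lk_integrand.
split => //; first exact: jump_measure_esscher.
- by move=> u hu; apply: integrable_density => //; apply: iu; left.
- move=> u hu.
  have -> : psi (u + b) = lk_exponent kappa a sigma Pi (u + b).
    apply: psiE; case: hu => hu; first by left; rewrite -ltrBlDr.
    by right; rewrite addr_ge0.
  have -> : psi b = lk_exponent kappa a sigma Pi b by apply: psiE; right.
  rewrite /lk_exponent /Rintegral integral_density; [|by []|exact: me].
  rewrite -!/(Rintegral _ _ _).
  have -> : \int[Pi]_(x in D) (lk_integrand u x * expR (b * x)) =
     \int[Pi]_(x in D) lk_integrand (u + b) x
     - \int[Pi]_(x in D) lk_integrand b x
     - u * \int[Pi]_(x in D) (trunc x * (expR (b * x) - 1)).
    rewrite (funext (lk_integrand_esscher u)) RintegralB//; last 2 first.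
    - by apply: integrableB_EFin => //; exact: iv.
    - exact: integrableZl_EFin.
    by rewrite RintegralB//; [rewrite RintegralZl|exact: iv].
  by field.
Qed.

End esscher.

(** * The quotient [psi u / u] *)

Section Phi.
Context (R : realType).
Variables (kappa a sigma : R).
Variables (Pi : {measure set (measurableTypeR R) -> \bar R}) (psi : R -> R).
Hypothesis jPi : jump_measure Pi.
Local Notation D := (`]-oo, (0 : R)[%classic : set (measurableTypeR R)).
Local Notation expint_integrable v := (Pi.-integrable D (EFin \o (fun x => expint v x + trunc x))).

Let measurable_expint_trunc v : measurable_fun D (fun x => expint v x + trunc x).
Proof.
apply: measurable_funD; [exact: measurable_expint|exact: measurable_trunc].
Qed.

Lemma integrable_expint_trunc v : v != 0 ->
  Pi.-integrable D (EFin \o lk_integrand v) -> expint_integrable v.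
Proof.
move=> v0 iv; rewrite (_ : (fun x => _) = (fun x => - v^-1 * lk_integrand v x)).
  exact: integrableZl_EFin.
by apply/funext => x; rewrite expint_trunc.
Qed.

Lemma integrable_expint0_trunc e : 0 < e ->
  Pi.-integrable D (EFin \o lk_integrand (- e)) -> expint_integrable 0.
Proof.
move=> e0 ie; apply: (@le_integrable_EFin _ _ _ _ _ _
  (fun x : measurableTypeR R => e^-1 * lk_integrand (- e) x)) => //.
  move=> x; rewrite /= in_itv/= => x0.
  by rewrite ger0_norm ?expint0_trunc_ge0// expint0_trunc_le.
exact: integrableZl_EFin.
Qed.

Lemma lk_exponent_div v : v != 0 ->
  Pi.-integrable D (EFin \o lk_integrand v) ->
  lk_exponent kappa a sigma Pi v / v =
  a + sigma ^+ 2 / 2 * v - kappa / v - \int[Pi]_(x in D) (expint v x + trunc x).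
Proof.
move=> v0 iv; rewrite /lk_exponent.
have -> : \int[Pi]_(x in D) (expint v x + trunc x) =
    - v^-1 * \int[Pi]_(x in D) lk_integrand v x.
  by rewrite -RintegralZl//; apply: eq_Rintegral => x _; rewrite expint_trunc.
by field.
Qed.

(** A squeeze between the bounds of [expint_le]. *)
Lemma cvg_expint (w : R^nat) x : x < 0 -> (forall n, 0 < w n) ->
  w n @[n --> \oo] --> 0 -> expint (w n) x @[n --> \oo] --> expint 0 x.
Proof.
move=> x0 w0 cw; apply: (@squeeze_cvgr _ _ _ _ (fun n => - x - w n * x ^+ 2)
  (fun=> - x)).
- by near=> n; rewrite expint_le.
- rewrite /expint eqxx -[X in _ --> X](subr0) -[in X in _ --> X](mul0r (x ^+ 2)).
  apply: (@cvgB _ R^o); first exact: cvg_cst.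
  by apply: cvgM => //; exact: cvg_cst.
- by rewrite /expint eqxx; exact: cvg_cst.
Unshelve. all: by end_near. Qed.

(** Dominated convergence; the dominating function is the one of
    [normr_expint_trunc_le], which is valid for [w <= 1]. *)
Let cvg_Rintegral_expint_le1 (w : R^nat) : expint_integrable 0 ->
  (forall n, 0 < w n <= 1) -> w n @[n --> \oo] --> 0 ->
  \int[Pi]_(x in D) (expint (w n) x + trunc x) @[n --> \oo] -->
  \int[Pi]_(x in D) (expint 0 x + trunc x).
Proof.
move=> i0 w01 cw.
have [] := @dominated_convergence _ _ _ Pi D (measurable_itv _)
  (fun n x => (expint (w n) x + trunc x)%:E)
  (fun x => (expint 0 x + trunc x)%:E)
  (fun x => (Num.min 1 (x ^+ 2) + (expint 0 x + trunc x))%:E).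
- by move=> n; apply/measurable_EFinP; exact: measurable_expint_trunc.
- apply/measurable_EFinP; exact: measurable_expint_trunc.
- apply: aeW => x; rewrite /= in_itv/= => x0; apply: cvg_EFin.
    by near=> n.
  apply: (@cvgD _ R^o); last exact: cvg_cst.
  by apply: cvg_expint => // n; have /andP[] := w01 n.
- by apply: integrableD_EFin => //; exact: integrable_minr_sqr.
- apply: aeW => x n; rewrite /= in_itv/= => x0; rewrite lee_fin.
  exact: normr_expint_trunc_le.
move=> _ _; rewrite -[X in _ --> X]fineK; last exact: integrable_fin_num i0.
by move=> /fine_cvgP[].
Unshelve. all: by end_near. Qed.

Lemma cvg_Rintegral_expint : expint_integrable 0 ->
  \int[Pi]_(x in D) (expint w x + trunc x) @[w --> 0^'+] -->
  \int[Pi]_(x in D) (expint 0 x + trunc x).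
Proof.
move=> i0; apply/cvg_at_rightP => w [w0 cw].
have [N _ w1] : \forall n \near \oo, w n <= 1.
  by apply: (cvgr_le _ cw); exact: ltr01.
rewrite -(cvg_shiftn N); apply: cvg_Rintegral_expint_le1 => //.
  by move=> n; rewrite w0/= w1//= leq_addl.
by rewrite (cvg_shiftn N w).
Qed.

Hypothesis psiE : forall w : R, 0 < w -> psi w = lk_exponent kappa a sigma Pi w.
Hypothesis ipsi : forall w : R, 0 < w -> Pi.-integrable D (EFin \o lk_integrand w).

Lemma cvg_psi_div0 : kappa = 0 -> expint_integrable 0 ->
  psi w / w @[w --> 0^'+] --> a - \int[Pi]_(x in D) (expint 0 x + trunc x).
Proof.
move=> k0 i0.
have : (a + sigma ^+ 2 / 2 * w - \int[Pi]_(x in D) (expint w x + trunc x))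
    @[w --> 0^'+] -->
    a + sigma ^+ 2 / 2 * 0 - \int[Pi]_(x in D) (expint 0 x + trunc x).
  apply: (@cvgB _ R^o); last exact: cvg_Rintegral_expint.
  apply: (@cvgD _ R^o); first exact: cvg_cst.
  apply: cvgM; first exact: cvg_cst.
  exact: cvg_at_right_filter.
rewrite mulr0 addr0; apply: cvg_trans; apply: near_eq_cvg; near=> w.
have w0 : 0 < w by [].
by rewrite psiE// lk_exponent_div ?gt_eqF//; [rewrite k0 mul0r subr0|exact: ipsi].
Unshelve. all: by end_near. Qed.

(** The integrals of [expint w x + trunc x] stay bounded as [w] decreases to
    [0], because they are given by the quotients [psi w / w].  Adding
    [Num.min 1 (x ^+ 2)] makes the integrands nonnegative, and Fatou's lemma
    bounds the integral of their limit. *)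
Lemma cvg_psi_div_integrable (L : R) : kappa = 0 ->
  psi w / w @[w --> 0^'+] --> L -> expint_integrable 0.
Proof.
move=> k0 /cvg_at_rightP cpsi.
have cL : psi (harmonic n) / harmonic n @[n --> \oo] --> L.
  by apply: cpsi; split; [move=> n; exact: harmonic_gt0|exact: cvg_harmonic].
have h0 n : harmonic n > 0 :> R by exact: harmonic_gt0.
have h1 n : harmonic n <= 1 :> R.
  by rewrite /harmonic /= invf_le1 // ler1n.
pose m := \int[Pi]_(x in D) (Num.min 1 (x ^+ 2)).
have im := integrable_minr_sqr jPi.
have mm : measurable_fun D (fun x => Num.min 1 (x ^+ 2)).
  by apply/measurable_EFinP; exact: measurable_int im.
pose f n (x : R) := expint (harmonic n) x + trunc x + Num.min 1 (x ^+ 2).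
have f0 n x : D x -> (0 <= (f n x)%:E)%E.
  rewrite /= in_itv/= => x0; rewrite lee_fin /f.
  have h01 : 0 < (harmonic n : R) <= 1 by rewrite h0 h1.
  by have /andP[h2 _] := expint_trunc_bounds h01 x0; lra.
have mf v : measurable_fun D
    (fun x => (expint v x + trunc x + Num.min 1 (x ^+ 2))%:E).
  by apply/measurable_EFinP; apply: measurable_funD.
have ih n : expint_integrable (harmonic n).
  by apply: integrable_expint_trunc; rewrite ?gt_eqF//; exact: ipsi.
have intf n : (\int[Pi]_(x in D) (f n x)%:E =
    (a + sigma ^+ 2 / 2 * harmonic n - psi (harmonic n) / harmonic n + m)%:E)%E.
  rewrite psiE// lk_exponent_div ?gt_eqF//; last exact: ipsi.
  rewrite k0 mul0r subr0 -[LHS]fineK; last first.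
    by apply: integrable_fin_num => //; exact: integrableD_EFin.
  have -> : fine (\int[Pi]_(x in D) (f n x)%:E)%E =
      \int[Pi]_(x in D) (expint (harmonic n) x + trunc x) + m.
    by rewrite /f -/(Rintegral _ _ _) [LHS]RintegralD//; exact: ih.
  by congr EFin; ring.
have cf : (\int[Pi]_(x in D) (f n x)%:E)%E @[n --> \oo] -->
    (a + sigma ^+ 2 / 2 * 0 - L + m)%:E.
  under eq_fun do rewrite intf.
  apply: cvg_EFin; first by near=> n.
  apply: (@cvgD _ R^o); last exact: cvg_cst.
  apply: (@cvgB _ R^o); last exact: cL.
  apply: (@cvgD _ R^o); first exact: cvg_cst.
  by apply: cvgM; [exact: cvg_cst|exact: cvg_harmonic].
have := fatou Pi (measurable_itv _) (fun n => mf (harmonic n)) f0.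
rewrite is_cvg_limn_einfE; last by apply/cvg_ex; eexists; exact: cf.
rewrite (cvg_lim _ cf)//.
rewrite (eq_integral (fun x : measurableTypeR R =>
    (expint 0 x + trunc x + Num.min 1 (x ^+ 2))%:E)); last first.
  move=> x /[!inE]; rewrite /= in_itv/= => x0.
  have cx : (f n x)%:E @[n --> \oo] -->
      (expint 0 x + trunc x + Num.min 1 (x ^+ 2))%:E.
    apply: cvg_EFin; first by near=> n.
    apply: (@cvgD _ R^o); last exact: cvg_cst.
    apply: (@cvgD _ R^o); last exact: cvg_cst.
    by apply: cvg_expint => //; exact: cvg_harmonic.
  rewrite is_cvg_limn_einfE; last by apply/cvg_ex; eexists; exact: cx.
  exact/cvg_lim.
move=> lef; apply: (@le_integrable_EFin _ _ _ _ _ _ (fun x : measurableTypeR R =>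
  expint 0 x + trunc x + Num.min 1 (x ^+ 2))) => //.
  move=> x; rewrite /= in_itv/= => x0.
  by rewrite ger0_norm ?expint0_trunc_ge0// lerDl minr_sqr_ge0.
apply/integrableP; split; first exact: mf.
rewrite (eq_integral (fun x : measurableTypeR R =>
    (expint 0 x + trunc x + Num.min 1 (x ^+ 2))%:E)).
  exact: le_lt_trans lef (ltry _).
move=> x /[!inE]; rewrite /= in_itv/= => x0.
by rewrite ger0_norm// addr_ge0 ?minr_sqr_ge0 ?expint0_trunc_ge0.
Unshelve. all: by end_near. Qed.

(** At [v = 0], [Phi] is defined as a limit, which [cvg_psi_div0] computes. *)
Lemma PhiE v : v != 0 \/ kappa = 0 /\ expint_integrable 0 ->
  psi v = lk_exponent kappa a sigma Pi v ->
  Pi.-integrable D (EFin \o lk_integrand v) ->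
  Phi psi v = a + sigma ^+ 2 / 2 * v - kappa / v
     - \int[Pi]_(x in D) (expint v x + trunc x).
Proof.
rewrite /Phi => v0 pv iv; case: eqVneq v0 => [->|v0 _]; last first.
  by rewrite pv lk_exponent_div.
move=> [//|[k0 i0]]; rewrite k0 mul0r mulr0 addr0 subr0.
exact/cvg_lim/cvg_psi_div0.
Qed.

End Phi.

(** * Operations on characteristics *)

Section laplace_exponent_operations.
Context (R : realType).
Implicit Types (ell kappa a sigma c : R) (psi : R -> R).
Implicit Types Pi : {measure set (measurableTypeR R) -> \bar R}.
Local Notation D := (`]-oo, (0 : R)[%classic : set (measurableTypeR R)).

Lemma laplace_exponent_of0 ell kappa a sigma Pi psi :
  laplace_exponent_of ell kappa a sigma Pi psi -> psi 0 = - kappa.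
Proof.
move=> [_ _ _ ->]; last by right.
rewrite /lk_exponent mulr0 expr0n/= mulr0 !addr0.
under eq_Rintegral do rewrite lk_integrand0.
by rewrite Rintegral_cst// mul0r addr0.
Qed.

Lemma laplace_exponent_le ell1 ell2 kappa a sigma Pi psi : ell1 <= ell2 ->
  laplace_exponent_of ell1 kappa a sigma Pi psi ->
  laplace_exponent_of ell2 kappa a sigma Pi psi.
Proof.
move=> le12 [k0 jPi ipsi psiE]; split=> // u hu.
  by apply: ipsi; rewrite (le_lt_trans le12).
by apply: psiE; case: hu => hu; [left; rewrite (le_lt_trans le12)|right].
Qed.

Lemma laplace_exponent_drift ell kappa a sigma c Pi psi :
  laplace_exponent_of ell kappa a sigma Pi psi ->
  laplace_exponent_of ell kappa (a + c) sigma Pi (fun u => psi u + c * u).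
Proof.
move=> [k0 jPi ipsi psiE]; split=> // u /psiE ->.
by rewrite /lk_exponent; ring.
Qed.

(** The variances add up, not the Gaussian coefficients. *)
Lemma laplace_exponent_add ell kappa1 kappa2 a1 a2 sigma Pi1 Pi2 psi1 psi2 :
  ell <= 0 ->
  laplace_exponent_of ell kappa1 a1 sigma Pi1 psi1 ->
  laplace_exponent_of ell kappa2 a2 0 Pi2 psi2 ->
  laplace_exponent_of ell (kappa1 + kappa2) (a1 + a2) sigma
    (measure_add Pi1 Pi2) (fun u => psi1 u + psi2 u).
Proof.
move=> l0 h1 h2.
have [k1 [Pi10 m1] _ E1] := h1; have [k2 [Pi20 m2] _ E2] := h2.
have mlk u : measurable_fun D (EFin \o lk_integrand u).
  by apply/measurable_EFinP; apply: measurable_lk_integrand.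
split.
- exact: addr_ge0.
- split; first by rewrite [LHS]measure_addE Pi10 Pi20 adde0.
  rewrite ge0_integral_measure_add//.
  + by rewrite lte_add_pinfty.
  + by move=> x _; rewrite lee_fin minr_sqr_ge0.
  + exact: measurable_int (integrable_minr_sqr (conj Pi10 m1)).
- move=> u hu; apply/integrableP; split; first exact: mlk.
  rewrite ge0_integral_measure_add//; last exact: measurableT_comp.
  have /integrableP[_ i1] : Pi1.-integrable D (EFin \o lk_integrand u).
    by apply: lk_integrable h1 _ => //; left.
  have /integrableP[_ i2] : Pi2.-integrable D (EFin \o lk_integrand u).
    by apply: lk_integrable h2 _ => //; left.
  by rewrite lte_add_pinfty.
- move=> u hu; rewrite E1// E2// /lk_exponent.
  have i1 := lk_integrable l0 h1 hu; have i2 := lk_integrable l0 h2 hu.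
  have -> : \int[measure_add Pi1 Pi2]_(x in D) lk_integrand u x =
      \int[Pi1]_(x in D) lk_integrand u x + \int[Pi2]_(x in D) lk_integrand u x.
    rewrite /Rintegral (integral_measure_add _ i1 i2)//.
    by rewrite fineD//; exact: integrable_fin_num.
  by ring.
Qed.

End laplace_exponent_operations.

(** * The contribution of [- delta * Phi] *)

Section laplace_exponent_tail.
Context (R : realType).
Variables (delta beta kappa : R) (Pi : {measure set (measurableTypeR R) -> \bar R}).
Hypotheses (delta_ge0 : 0 <= delta) (beta_ge0 : 0 <= beta) (kappa_ge0 : 0 <= kappa).
Hypothesis jPi : jump_measure Pi.
Local Notation D := (`]-oo, (0 : R)[%classic : set (measurableTypeR R)).
Local Notation nu := (tail_measure beta delta_ge0 kappa_ge0 jPi).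
Local Notation expint_integrable v :=
  (Pi.-integrable D (EFin \o (fun x => expint v x + trunc x))).

Hypothesis cb : expint_integrable beta.
Hypothesis kb : kappa = 0 \/ 0 < beta.

Let integrable_expintB u : expint_integrable (u + beta) ->
  Pi.-integrable D (EFin \o (fun x => expint (u + beta) x - expint beta x)).
Proof.
move=> cu; rewrite (_ : (fun x => _) = fun x =>
  (expint (u + beta) x + trunc x) - (expint beta x + trunc x)).
  exact: integrableB_EFin.
by apply/funext => x; ring.
Qed.

Let integrable_nu_expRB1 u : expint_integrable (u + beta) -> kappa = 0 \/ 0 < u + beta ->
  nu.-integrable D (EFin \o (fun x => expR (u * x) - 1)).
Proof.
move=> cu ku; apply: integrable_tail_expRB1; first exact: integrable_expintB.
by case: kb ku => [->|b0 [->|]]; [left|left|right].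
Qed.

Hypothesis c1 : expint_integrable (1 + beta).

(** The point [u = 1] is always in the domain, and its case alone controls [nu]
    at [0] and at [-oo]. *)
Let integrable_nu_1BexpR : nu.-integrable D (EFin \o (fun x => 2 * (1 - expR x))).
Proof.
have b1 : 0 < 1 + beta by rewrite ltr_pwDl.
have i1 : nu.-integrable D (EFin \o (fun x => expR (1 * x) - 1)).
  by apply: integrable_nu_expRB1 => //; right.
rewrite (_ : (fun x => _) = fun x => -2 * (expR (1 * x) - 1)).
  exact: integrableZl_EFin.
by apply/funext => x; rewrite mul1r; ring.
Qed.

Lemma integrable_nu_trunc : nu.-integrable D (EFin \o @trunc R).
Proof.
apply: (@le_integrable_EFin _ _ _ _ _ _
  (fun x : measurableTypeR R => 2 * (1 - expR x))) => //.
  exact: measurable_trunc.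
by move=> x; rewrite /= in_itv/= => x0; exact: normr_trunc_le_expRB1.
Qed.

Lemma jump_measure_tail : jump_measure nu.
Proof.
split; first exact: tail_measure_itvcy.
have /integrableP[_] := integrable_nu_1BexpR.
apply: le_lt_trans; apply: ge0_le_integral => //.
- by move=> x _; rewrite lee_fin minr_sqr_ge0.
- exact: measurable_int (integrable_minr_sqr jPi).
- by apply: measurableT_comp => //; exact: measurable_int integrable_nu_1BexpR.
- move=> x; rewrite /= in_itv/= => x0; rewrite lee_fin.
  by rewrite (le_trans (minr_sqr_le_expRB1 x0))// ler_norm.
Qed.

(** The process has bounded variation: its exponent is the integral of
    [expR (u * x) - 1], and the drift only undoes the compensation of the small
    jumps. *)
Lemma laplace_exponent_tail ell psi :
  (forall u, ell < u \/ 0 <= u -> [/\ expint_integrable (u + beta),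
    kappa = 0 \/ 0 < u + beta &
    psi u = delta * (kappa * ((u + beta)^-1 - beta^-1) +
      \int[Pi]_(x in D) (expint (u + beta) x - expint beta x))]) ->
  laplace_exponent_of ell 0 (\int[nu]_(x in D) trunc x) 0 nu psi.
Proof.
move=> H.
have ie u : ell < u \/ 0 <= u ->
    nu.-integrable D (EFin \o (fun x => expR (u * x) - 1)).
  by move=> /H[cu ku _]; exact: integrable_nu_expRB1.
have it := integrable_nu_trunc.
split => //; first exact: jump_measure_tail.
- move=> u hu; rewrite (funext (lk_integrandE u)).
  apply: integrableB_EFin => //; first by apply: ie; left.
  exact: integrableZl_EFin.
- move=> u hu; have [cu ku ->] := H u hu.
  rewrite /lk_exponent (funext (lk_integrandE u)) [X in _ = _ + X]RintegralB//; last 2 first.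
    exact: ie.
    exact: integrableZl_EFin.
  rewrite RintegralZl// Rintegral_tail_expRB1; last 2 first.
    exact: integrable_expintB.
    by case: kb ku => [->|b0 [->|]]; [left|left|right].
  by ring.
Qed.

End laplace_exponent_tail.

(** If [delta = 0], then the domain may extend to the left of [- beta] despite a
    killing, so that the hypotheses of [laplace_exponent_tail] fail; but the
    measure vanishes. *)
Lemma laplace_exponent_tail0 (R : realType) (ell delta beta kappa : R)
    (Pi : {measure set (measurableTypeR R) -> \bar R})
    (delta_ge0 : 0 <= delta) (kappa_ge0 : 0 <= kappa) (jPi : jump_measure Pi) :
  delta = 0 ->
  laplace_exponent_of ell 0 0 0
    (tail_measure beta delta_ge0 kappa_ge0 jPi) (fun=> 0).
Proof.
set nu := tail_measure _ _ _ _ => delta0.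
have nu0 A : nu A = 0%E.
  apply: integral0_eq => x _; rewrite /tail_density patchE.
  by case: ifP; rewrite // delta0 !mul0r.
have int0 D f : (\int[nu]_(x in D) f x = 0)%E.
  by rewrite (eq_measure_integral mzero) ?integral_measure_zero// => A _ _; exact: nu0.
split => //.
- by split; [exact: nu0|rewrite int0].
- move=> u _; apply/integrableP; split; last by rewrite int0.
  by apply/measurable_EFinP; apply: measurable_lk_integrand.
- by move=> u _; rewrite /lk_exponent /Rintegral int0/=; ring.
Qed.

(** * The transformed exponent *)

(** The Esscher part and the part coming from [Phi] add up.  The Gaussian
    component contributes [- delta * sigma ^+ 2 / 2 * u] to the latter; it is
    moved to the drift of the former. *)
Lemma laplace_exponent_Ttrans (R : realType) (ell : R) (psi : R -> R)
    (delta beta : R) (kappa a sigma : R)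
    (Pi : {measure set (measurableTypeR R) -> \bar R}) :
  ell <= 0 -> 0 <= delta -> 0 <= beta ->
  (beta = 0 ->
    psi 0 = 0 /\ (psi h - psi 0) / h @[h --> (0 : R)^'+] --> (0 : R)) ->
  laplace_exponent_of ell kappa a sigma Pi psi ->
  exists a' (Pi' : {measure set (measurableTypeR R) -> \bar R}),
    laplace_exponent_of (Ttrans_abscissa ell delta psi - beta) 0 a' sigma Pi'
      (Ttrans delta beta psi) /\
    forall A : set (measurableTypeR R),
      measurable A -> A `<=` `]-oo, 0[ ->
      Pi' A = Ttrans_jump delta beta kappa Pi A.
Proof.
move=> ell_le0 delta_ge0 beta_ge0 beta0 hpsi.
have [kappa_ge0 jPi _ psiE] := hpsi.
have psi0 := laplace_exponent_of0 hpsi.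
have lkint := lk_integrable ell_le0 hpsi.
set ell' := Ttrans_abscissa ell delta psi.
have [ell_le ell'_le0] : ell <= ell' /\ ell' <= 0.
  by rewrite /ell' /Ttrans_abscissa; case: ifP.
pose nu := tail_measure beta delta_ge0 kappa_ge0 jPi.
suff [a2 h2] : exists a2, laplace_exponent_of (ell' - beta) 0 a2 0 nu
    (fun u => - delta * (Phi psi (u + beta) - Phi psi beta)
              + delta * (sigma ^+ 2 / 2) * u).
  have le' : ell - beta <= ell' - beta by rewrite lerD2r.
  have := laplace_exponent_esscher beta_ge0 jPi ell_le0 hpsi.
  move=> /(laplace_exponent_le le').
  move=> /(laplace_exponent_drift (- (delta * (sigma ^+ 2 / 2)))) h1.
  have l0 : ell' - beta <= 0 by rewrite subr_le0 (le_trans ell'_le0).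
  have := laplace_exponent_add l0 h1 h2; rewrite addr0 => h.
  eexists; eexists; split.
    move: h; congr laplace_exponent_of; apply/funext => u.
    by rewrite /Ttrans; ring.
  by move=> A mA AD; rewrite [LHS]measure_addE tail_measureE// /Ttrans_jump addeA.
have [delta0|delta_neq0] := eqVneq delta 0.
  exists 0; rewrite (_ : (fun u => _) = fun=> 0).
    exact: laplace_exponent_tail0.
  by apply/funext => u; rewrite delta0; ring.
have ell'E : ell' = if kappa == 0 then ell else 0.
  by rewrite /ell' /Ttrans_abscissa psi0 mulf_eq0 oppr_eq0 (negbTE delta_neq0).
pose expint_integrable v := Pi.-integrable `]-oo, 0[%classic
  (EFin \o (fun x => expint v x + trunc x)).
have kb : kappa = 0 \/ 0 < beta.
  have [b0|b0] := eqVneq beta 0; last by right; rewrite lt_def b0.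
  by left; have [] := beta0 b0; rewrite psi0 => /eqP; rewrite oppr_eq0 => /eqP.
have psi_pos w : 0 < w -> psi w = lk_exponent kappa a sigma Pi w.
  by move=> w0; apply: psiE; right; exact: ltW.
have lk_pos w : 0 < w -> Pi.-integrable `]-oo, 0[%classic (EFin \o lk_integrand w).
  by move=> w0; apply: lkint; right; exact: ltW.
(* If [ell] is negative, any exponential moment between [ell] and [0] controls
   the large jumps; take the midpoint. *)
have c0 : kappa = 0 -> ell < 0 \/ beta = 0 -> expint_integrable 0.
  move=> k0 [l0|b0].
    apply: (@integrable_expint0_trunc _ _ (- ell / 2)); first by lra.
    by apply: lkint; left; lra.
  have [psi00 cpsi] := beta0 b0.
  apply: (cvg_psi_div_integrable jPi psi_pos lk_pos k0 (L := 0)).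
  by move: cpsi; rewrite psi00; under eq_fun do rewrite subr0.
(* If [kappa] is nonzero then [ell' = 0] and [beta] is positive, so that
   [u + beta] stays positive; if [u + beta = 0] then [ell] is negative or
   [beta] vanishes. *)
have dom u : ell' - beta < u \/ 0 <= u ->
    [/\ expint_integrable (u + beta), kappa = 0 \/ 0 < u + beta,
        u + beta != 0 \/ kappa = 0 /\ expint_integrable 0 &
        ell < u + beta \/ 0 <= u + beta].
  move=> hu.
  have hv : ell < u + beta \/ 0 <= u + beta.
    case: hu => hu; [left|by right; rewrite addr_ge0].
    by rewrite (le_lt_trans ell_le)// -ltrBlDr.
  have kv : kappa = 0 \/ 0 < u + beta.
    have [k0|k0] := eqVneq kappa 0; [by left|right].
    case: kb k0 => [->|b0 k0]; first by rewrite eqxx.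
    case: hu => hu; last by rewrite ltr_wpDl.
    by move: hu; rewrite ell'E (negbTE k0) sub0r -subr_gt0 opprK.
  have [v0|v0] := eqVneq (u + beta) 0; last first.
    split => //; last by left.
    by apply: integrable_expint_trunc => //; exact: lkint.
  have k0 : kappa = 0 by case: kv => //; rewrite v0 ltxx.
  have ci : expint_integrable 0.
    apply: c0 => //; case: hu => hu; last by right; lra.
    by left; move: hu; rewrite ell'E k0 eqxx; lra.
  by split; rewrite ?v0//; [left|right|right].
have [cb _ zb hb] : [/\ expint_integrable beta, kappa = 0 \/ 0 < beta,
    beta != 0 \/ kappa = 0 /\ expint_integrable 0 & ell < beta \/ 0 <= beta].
  by have := dom 0; rewrite add0r; apply; right.
have [c1 _ _ _] := dom 1 (or_intror ler01).
eexists; apply: laplace_exponent_tail => //.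
move=> u hu.
have [cv kv zv hv] := dom u hu; split => //.
have PhivE := PhiE jPi psi_pos lk_pos zv (psiE _ hv) (lkint _ hv).
have PhibE := PhiE jPi psi_pos lk_pos zb (psiE _ hb) (lkint _ hb).
have -> : \int[Pi]_(x in `]-oo, 0[) (expint (u + beta) x - expint beta x) =
    \int[Pi]_(x in `]-oo, 0[) (expint (u + beta) x + trunc x) -
    \int[Pi]_(x in `]-oo, 0[) (expint beta x + trunc x).
  by rewrite -RintegralB//; apply: eq_Rintegral => x _; ring.
by rewrite PhivE PhibE; ring.
Qed.

Theorem proposition2p2 (R : realType) (ell : R) (psi : R -> R)
    (delta beta : R) (ell_le0 : ell <= 0) (psi_ell : Psi ell psi)
    (delta_ge0 : 0 <= delta) (beta_ge0 : 0 <= beta)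
    (beta0 : beta = 0 ->
       psi 0 = 0 /\ (psi h - psi 0) / h @[h --> (0 : R)^'+] --> (0 : R)) :
  let ell' := Ttrans_abscissa ell delta psi in
  [/\ Psi (ell' - beta) (Ttrans delta beta psi),
      Psi (ell - beta) `<=` Psi ell,
      (forall kappa a sigma Pi,
         laplace_exponent_of (ell' - beta) kappa a sigma Pi
           (Ttrans delta beta psi) -> kappa = 0) &
      (forall kappa a sigma Pi,
         laplace_exponent_of ell kappa a sigma Pi psi ->
         exists a' (Pi' : {measure set (measurableTypeR R) -> \bar R}),
           laplace_exponent_of (ell' - beta) 0 a' sigma Pi'
             (Ttrans delta beta psi) /\
           forall A : set (measurableTypeR R),
             measurable A -> A `<=` `]-oo, 0[ ->
             Pi' A = Ttrans_jump delta beta kappa Pi A)].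
Proof.
move=> ell'; split.
- have [kappa [a [sigma [Pi hpsi]]]] := psi_ell.
  have [a' [Pi' [h _]]] :=
    laplace_exponent_Ttrans ell_le0 delta_ge0 beta_ge0 beta0 hpsi.
  by exists 0, a', sigma, Pi'.
- move=> f [kappa [a [sigma [Pi h]]]]; exists kappa, a, sigma, Pi.
  by apply: laplace_exponent_le h; rewrite gerBl.
- move=> kappa a sigma Pi /laplace_exponent_of0/eqP.
  by rewrite /Ttrans add0r !subrr mulr0 subrr eq_sym oppr_eq0 => /eqP.
- by move=> kappa a sigma Pi; exact: laplace_exponent_Ttrans.
Qed.
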